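(* Let $A\in U(n)$. Then each one of the following conditions is equivalent to the existence of a biunimodular vector for $A$: (a) $A\in\mathcal{D}\cdot\mathrm{Fix}(\mathbf{1})\cdot\mathcal{D}_1$; (a') $A'\in\mathcal{D}'\cdot \mathrm{E}(\mathbf{1})\cdot\mathcal{D}'$; (b) $\|A\|_{\infty\to1}=n$; (c) $\sup_{u\in\mathbb{T}^n}|\pi_A(u)|=1$; (d) $A(\mathbb{T}^n)\cap\mathbb{T}^n\neq\emptyset$.
   Context: $\mathbb{T}=\{z\in\mathbb{C}:|z|=1\}$. A biunimodular vector for $A\in U(n)$ is a vector $v\in\mathbb{C}^n$ such that both $v$ and $Av$ have all entries of modulus one. $\mathbf{1}=(1,\dots,1)\in\mathbb{C}^n$. $\mathcal{D}\subseteq U(n)$ is the subgroup of diagonal matrices with diagonal entries in $\mathbb{T}$; $\mathcal{D}_1\subseteq\mathcal{D}$ is the subgroup of those with first diagonal entry equal to $1$; $\mathrm{Fix}(\mathbf{1})=\{S\in U(n):S\mathbf{1}=\mathbf{1}\}$. $A'=\lambda A$ with $\lambda\in\mathbb{C}$ such that $\lambda^n=\overline{\det(A)}$, so $A'\in SU(n)$; $\mathcal{D}'=\mathcal{D}\cap SU(n)$; $\mathrm{E}(\mathbf{1})$ is the subgroup of those matrices in $SU(n)$ that have $\mathbf{1}$ as an eigenvector. Products of subsets of the group are sets of products of elements. $\|A\|_{\infty\to1}=\sup_{\|u\|_\infty=1}\|Au\|_1$ is the operator norm from $(\mathbb{C}^n,\|\cdot\|_\infty)$ to $(\mathbb{C}^n,\|\cdot\|_1)$,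 with $\|u\|_1=\sum_k|u_k|$ and $\|u\|_\infty=\max_k|u_k|$. $\pi_A(u)=\prod_{k=1}^n (Au)_k$. *)

(* Defs.v *)
From mathcomp Require Import all_boot all_order all_algebra.
From mathcomp Require Import complex.
From mathcomp Require Import boolp classical_sets reals.

Set Implicit Arguments.
Unset Strict Implicit.
Unset Printing Implicit Defensive.

Import Order.TTheory GRing.Theory Num.Theory.

Local Open Scope classical_set_scope.
Local Open Scope ring_scope.

(* The dimension is written n.+1 because it is positive: a first diagonal
   entry has to exist. *)
Section Biunimodular.
Variables (R : realType) (n : nat).
Local Notation C := (R[i]).
Local Notation M := 'M[C]_n.+1.
Local Notation V := 'cV[C]_n.+1.

(* `|z| is an element of R[i] with zero imaginary part; suprema are taken
   in R. *)
Definition modulus (z : C) : R := complex.Re `|z|.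

Definition ones : V := const_mx 1.

Definition torus : set V := [set u : V | forall k, `|u k 0| = 1].

Definition biunimodular (A : M) (v : V) : Prop := torus v /\ torus (A *m v).

Definition unitary_group : set M := [set A : M | A \is unitarymx].

Definition special_unitary_group : set M :=
  [set A | unitary_group A /\ \det A = 1].

Definition diag_group : set M :=
  [set D | is_diag_mx D /\ forall k, `|D k k| = 1].

Definition diag_group1 : set M := [set D | diag_group D /\ D 0 0 = 1].

Definition fix_ones : set M := [set S | unitary_group S /\ S *m ones = ones].

Definition special_diag_group : set M := diag_group `&` special_unitary_group.

Definition eigen_ones : set M :=
  [set S | special_unitary_group S /\ exists c : C, S *m ones = c *: ones].

Definition mulset (X Y : set M) : set M := [set P *m Q | P in X & Q in Y].

Definition norm1 (u : V) : R := \sum_k modulus (u k 0).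

Definition norm_sup (u : V) : R := \big[Num.max/0]_k modulus (u k 0).

Definition opnorm_sup_1 (A : M) : R :=
  sup [set norm1 (A *m u) | u in [set u | norm_sup u = 1]].

Definition coord_prod (A : M) (u : V) : C := \prod_k (A *m u) k 0.

End Biunimodular.

Arguments ones {R n}.
Arguments torus {R n}.
Arguments unitary_group {R n}.
Arguments special_unitary_group {R n}.
Arguments diag_group {R n}.
Arguments diag_group1 {R n}.
Arguments fix_ones {R n}.
Arguments special_diag_group {R n}.
Arguments eigen_ones {R n}.

(* Main.v *)
(** For A unitary and |u_k| <= 1, expanding squares and using ||Au||_2 = ||u||_2 gives
      sum_k (|(Au)_k| - 1)^2 + sum_k (1 - |u_k|^2) = 2 (n - ||Au||_1),
    with nonnegative summands on the left. Hence ||Au||_1 <= n, with equality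
    exactly when u is biunimodular, and by compactness of the polydisc a
    biunimodular vector exists as soon as ||Au||_1 comes arbitrarily close to n;
    this gives (b), and (c) by AM-GM. For (a) and (a'), a biunimodular v with
    w = Av turns diag(w)^-1 A diag(v) into a unitary matrix fixing the vector 1;
    rescaling v makes v_1 = 1, and rescaling v and w independently makes both
    diagonal determinants 1, at the price of 1 becoming only an eigenvector. *)

Require Import Defs.
From mathcomp Require Import all_boot all_order all_algebra.
From mathcomp Require Import complex ring.
From mathcomp Require Import boolp classical_sets reals.
From mathcomp Require Import topology normedtype derive realfun.

Set Implicit Arguments.
Unset Strict Implicit.
Unset Printing Implicit Defensive.

Import Order.TTheory GRing.Theory Num.Theory.

Local Open Scope classical_set_scope.
Local Open Scope ring_scope.

(** * Real-valued moduli and unimodular roots *)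

Section Modulus.
Variable R : realType.
Implicit Types z : R[i].

Lemma modulusE z : (modulus z)%:C%C = `|z|.
Proof. by rewrite /modulus RRe_real ?normr_real. Qed.

Lemma modulus_ge0 z : 0 <= modulus z.
Proof. by rewrite -ler0c modulusE. Qed.

Lemma modulus_eq1 z : modulus z = 1 <-> `|z| = 1.
Proof. by rewrite -modulusE; split=> [-> //|/complexI]. Qed.

Lemma modulus_prod (I : finType) (F : I -> R[i]) :
  modulus (\prod_i F i) = \prod_i modulus (F i).
Proof.
apply: complexI; rewrite modulusE normr_prod rmorph_prod.
by apply: eq_bigr => i _ /=; rewrite modulusE.
Qed.

(** [R[i]] is algebraically closed, and the modulus of a root is a nonnegative real whose power is
    1. Used to normalise products of diagonal entries. *)
Lemma unimodular_root m z :
  `|z| = 1 -> exists2 w : R[i], w ^+ m.+1 = z & `|w| = 1.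
Proof.
move=> z1; exists (m.+1.-root z); first exact: rootCK.
by apply/eqP; rewrite -(@pexpr_eq1 _ _ m.+1) // -normrX rootCK // z1.
Qed.

End Modulus.

(** * The norm defect identity and its equality case *)

Section Unitary.
Variables (R : realType) (n : nat).
Local Notation C := R[i].
Implicit Types (A S D : 'M[C]_n.+1) (u v : 'cV[C]_n.+1).

Lemma unitary_sum_norm2 A u : A \is unitarymx ->
  \sum_k `|(A *m u) k 0| ^+ 2 = \sum_k `|u k 0| ^+ 2.
Proof.
move=> Au.
have E v : \sum_k `|v k 0| ^+ 2 = (v ^t* *m v)%sesqui 0 0.
  by rewrite mxE; apply: eq_bigr => k _; rewrite normCKC !mxE.
rewrite !E trmx_mul map_mxM -mulmxA; congr ((_ *m _) _ _).
(* Unitarity is stated as [A] times its adjoint; the expanded norm needs the adjoint on the left,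
   which is equivalent for square matrices. *)
have /mulmx1C H := elimT unitarymxP Au.
by rewrite mulmxA H mul1mx.
Qed.

Lemma norm1_defect A u : A \is unitarymx ->
  \sum_k (modulus ((A *m u) k 0) - 1) ^+ 2 + \sum_k (1 - modulus (u k 0) ^+ 2)
  = 2 * (n.+1%:R - norm1 (A *m u)).
Proof.
move=> Au; have H := unitary_sum_norm2 u Au.
have {}H : \sum_k modulus ((A *m u) k 0) ^+ 2 = \sum_k modulus (u k 0) ^+ 2.
  have E (v : 'cV[C]_n.+1) :
      (\sum_k modulus (v k 0) ^+ 2)%:C%C = \sum_k `|v k 0| ^+ 2.
    by rewrite rmorph_sum; apply: eq_bigr => k _; rewrite rmorphXn /= modulusE.
  by apply: complexI; rewrite !E.
have -> : \sum_k (modulus ((A *m u) k 0) - 1) ^+ 2 =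
    \sum_k modulus ((A *m u) k 0) ^+ 2 - 2 * norm1 (A *m u) + n.+1%:R.
  have -> : n.+1%:R = \sum_(k < n.+1) (1 : R) by rewrite sumr_const card_ord.
  rewrite mulr_sumr -sumrB -big_split; apply: eq_bigr => k _ /=; ring.
rewrite sumrB sumr_const card_ord H; ring.
Qed.

Lemma norm1_le A u : A \is unitarymx -> (forall k, modulus (u k 0) <= 1) ->
  norm1 (A *m u) <= n.+1%:R.
Proof.
move=> Au u1; rewrite -subr_ge0 -(@pmulr_rge0 _ 2) // -norm1_defect //.
apply: addr_ge0; apply: sumr_ge0 => k _; first exact: sqr_ge0.
by rewrite subr_ge0 exprn_ile1 ?modulus_ge0.
Qed.

(** Equality makes the defect zero, so two sums of nonnegative terms vanish, hence each term
    does. *)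
Lemma norm1_eq A u : A \is unitarymx -> (forall k, modulus (u k 0) <= 1) ->
  norm1 (A *m u) = n.+1%:R -> biunimodular A u.
Proof.
move=> Au u1 E; have := norm1_defect u Au; rewrite E subrr mulr0 => /eqP.
rewrite paddr_eq0; last 2 first.
- by apply: sumr_ge0 => k _; exact: sqr_ge0.
- by apply: sumr_ge0 => k _; rewrite subr_ge0 exprn_ile1 ?modulus_ge0.
case/andP=> /eqP P /eqP Q; split=> k; apply/modulus_eq1; apply/eqP.
- rewrite -(@pexpr_eq1 _ _ 2) ?modulus_ge0 // eq_sym -subr_eq0; apply/eqP.
  apply: (psumr_eq0P _ Q) => // i _.
  by rewrite subr_ge0 exprn_ile1 ?modulus_ge0.
- rewrite -subr_eq0 -sqrf_eq0; apply/eqP.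
  by apply: (psumr_eq0P _ P) => // i _; exact: sqr_ge0.
Qed.

Lemma torus_modulus u : torus u -> forall k, modulus (u k 0) = 1.
Proof. by move=> tu k; apply/modulus_eq1. Qed.

Lemma norm1_torus u : torus u -> norm1 u = n.+1%:R.
Proof.
move=> /torus_modulus tu; rewrite /norm1 (eq_bigr (fun=> 1)) //.
by rewrite sumr_const card_ord.
Qed.

Lemma norm_sup_torus u : torus u -> norm_sup u = 1.
Proof.
move=> /torus_modulus tu; apply/eqP; rewrite eq_le; apply/andP; split.
  by apply: bigmax_le => // k _; rewrite tu.
(* The maximum starts from 0, so the value 1 must come from an actual coordinate; index 0 exists
   because the dimension is positive. *)
by rewrite -(tu 0); exact: le_bigmax.
Qed.

Lemma torus_ones : torus (@ones R n).
Proof. by move=> k; rewrite mxE normr1. Qed.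

Lemma modulus_le_norm_sup u k : modulus (u k 0) <= norm_sup u.
Proof. exact: (le_bigmax 0 (fun k => modulus (u k 0))). Qed.

End Unitary.

(** * Attaining the maximum on the polydisc *)

Section Compactness.
Import numFieldNormedType.Exports.
Variables (R : realType) (n : nat).
Local Notation C := R[i].

(* R[i] carries no compactness theory: the polydisc is parametrised by the
   real and imaginary parts of the coordinates. *)
Definition real_coords (x : 'rV[R]_(n.+1 + n.+1)) : 'cV[C]_n.+1 :=
  \col_k (x 0 (lshift n.+1 k) +i* x 0 (rshift n.+1 k))%C.

Lemma modulus_continuous (A : 'M[C]_n.+1) k :
  continuous (fun x => modulus ((A *m real_coords x) k 0)).
Proof.
have cM (f g : 'rV[R]_(n.+1 + n.+1) -> R) :
    continuous f -> continuous g -> continuous (fun x => f x * g x).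
  by move=> cf cg x; exact: (continuousM (cf x) (cg x)).
have cD (f g : 'rV[R]_(n.+1 + n.+1) -> R) :
    continuous f -> continuous g -> continuous (fun x => f x + g x).
  by move=> cf cg x; exact: (continuousD (cf x) (cg x)).
have csum (I : finType) (f : I -> 'rV[R]_(n.+1 + n.+1) -> R) :
    (forall i, continuous (f i)) -> continuous (fun x => \sum_i f i x).
  by move=> cf; apply: continuous_big => //; exact: add_continuous.
have cc i : continuous (fun x : 'rV[R]_(n.+1 + n.+1) => x 0 i).
  exact: coord_continuous.
have cst (c : R) : continuous (fun _ : 'rV[R]_(n.+1 + n.+1) => c).
  exact: cst_continuous.
(* [re] and [im] are the real and imaginary parts of the [k]-th coordinate of the image, as real
   linear forms in [x]. *)
pose re (x : 'rV[R]_(n.+1 + n.+1)) :=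
  \sum_j (complex.Re (A k j) * x 0 (lshift n.+1 j)
               + - complex.Im (A k j) * x 0 (rshift n.+1 j)) : R.
pose im (x : 'rV[R]_(n.+1 + n.+1)) :=
  \sum_j (complex.Re (A k j) * x 0 (rshift n.+1 j)
               + complex.Im (A k j) * x 0 (lshift n.+1 j)) : R.
have cre : continuous re.
  by apply: csum => j; apply: cD; apply: cM => //; exact: cst.
have cim : continuous im.
  by apply: csum => j; apply: cD; apply: cM => //; exact: cst.
have E x : (A *m real_coords x) k 0 = (re x +i* im x)%C.
  rewrite mxE; apply/eqP; rewrite eq_complex; apply/andP; split; apply/eqP.
    rewrite (raddf_sum (@complex.Re R : {additive Rcomplex R -> R})) /=.
    by apply: eq_bigr => j _; rewrite mxE; case: (A k j) => a b /=; ring.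
  rewrite (raddf_sum (@complex.Im R : {additive Rcomplex R -> R})) /=.
  by apply: eq_bigr => j _; rewrite mxE; case: (A k j) => a b /=; ring.
rewrite (_ : (fun x => _) = fun x => Num.sqrt (re x * re x + im x * im x)).
  have c : continuous (fun x => re x * re x + im x * im x).
    by apply: cD; apply: cM.
  by move=> x; exact: (continuous_comp (c x) (@sqrt_continuous R _)).
by apply/funext => x; rewrite E /modulus normc_def /= !expr2.
Qed.

Definition polydisc : set 'rV[R]_(n.+1 + n.+1) :=
  [set x | forall k, modulus (real_coords x k 0) <= 1].

(** The polydisc is a closed subset of a compact real cube. *)
Lemma compact_polydisc : compact polydisc.
Proof.
pose box : set 'rV[R]_(n.+1 + n.+1) :=
  [set x | forall i, `[-1, 1]%classic (x ord0 i)].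
apply: (@subclosed_compact _ _ box).
(* Inserting [1%:M] turns each coordinate modulus into an instance of [modulus_continuous]. *)
- rewrite (_ : polydisc = \bigcap_k
      ((fun x => modulus ((1%:M *m real_coords x) k 0)) @^-1` [set r | r <= 1])).
    apply: closed_bigI => k _; apply: closed_comp; last exact: closed_le.
    by move=> x _; exact: modulus_continuous.
  apply/seteqP; split=> x /= H k => [_|]; first by rewrite /= mul1mx; exact: H.
  by have := H k I; rewrite /= mul1mx.
- apply: (@rV_compact R _ (fun=> `[-1, 1]%classic)) => i.
  exact: segment_compact.
- move=> x H i /=; rewrite in_itv /= -ler_norml.
  have key (a b : R) : modulus (a +i* b)%C <= 1 -> `|a| <= 1 /\ `|b| <= 1.
    rewrite /modulus normc_def /= => h; split; rewrite -sqrtr_sqr;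
      apply: le_trans h; apply: ler_wsqrtr; first by rewrite lerDl sqr_ge0.
    by rewrite lerDr sqr_ge0.
  by case: (split_ordP i) => k ->; have := H k; rewrite mxE => /key[].
Qed.

(** The suprema in (b) and (c) are not known to be attained, so the hypothesis is approximate. A
    maximiser on the polydisc beats every approximant, so its value is [n.+1] and [norm1_eq]
    applies. *)
Lemma biunimodular_of_norm1_approx (A : 'M[C]_n.+1) : A \is unitarymx ->
  (forall e : R, 0 < e -> exists2 u : 'cV[C]_n.+1,
     forall k, modulus (u k 0) <= 1 & n.+1%:R - e < norm1 (A *m u)) ->
  exists v, biunimodular A v.
Proof.
move=> Au approx.
have real_coordsP (u : 'cV[C]_n.+1) : exists x, u = real_coords x.
  exists (row_mx (\row_k complex.Re (u k 0)) (\row_k complex.Im (u k 0))).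
  by apply/colP => k; rewrite !mxE (unsplitK (inl _)) (unsplitK (inr _)) !mxE;
    case: (u k 0).
have : {within polydisc, continuous (fun x => norm1 (A *m real_coords x))}.
  apply: continuous_subspaceT; apply: continuous_big => [|k _].
    exact: add_continuous.
  exact: modulus_continuous.
case/(compact_EVT_max _ compact_polydisc).
  (* The tolerance 1 is arbitrary: only a point of [polydisc] is wanted. *)
  have [u u1 _] := approx 1 ltr01; have [x E] := real_coordsP u.
  by exists x; rewrite /polydisc /= -E.
move=> x; rewrite inE => xK xmax; exists (real_coords x).
apply: norm1_eq => //; apply/eqP; rewrite eq_le norm1_le //=.
apply/ler_addgt0Pr => e e0; have [u u1 ue] := approx e e0.
have [y E] := real_coordsP u; rewrite -lerBlDr.
apply: (le_trans (ltW ue)); rewrite E; apply: xmax.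
by rewrite inE /polydisc /= -E.
Qed.

End Compactness.

(** * Diagonal unitary matrices as torus vectors *)

Section Diagonal.
Variables (R : realType) (n : nat).
Local Notation C := R[i].
Implicit Types (A S D : 'M[C]_n.+1) (u v w : 'cV[C]_n.+1).

Definition diag_of u : 'M[C]_n.+1 := diag_mx u^T.

Definition entry_inv u : 'cV[C]_n.+1 := \col_k (u k 0)^-1.

Lemma diag_ofM u v : diag_of u *m v = \col_k (u k 0 * v k 0).
Proof. by apply/colP => k; rewrite mul_diag_mx !mxE. Qed.

Lemma diag_of_ones u : diag_of u *m ones = u.
Proof. by rewrite diag_ofM; apply/colP => k; rewrite !mxE mulr1. Qed.

Lemma torus_neq0 u k : torus u -> u k 0 != 0.
Proof. by move=> tu; rewrite -normr_eq0 tu oner_eq0. Qed.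

Lemma torus_inv u : torus u -> torus (entry_inv u).
Proof. by move=> tu k; rewrite mxE normfV tu invr1. Qed.

Lemma torus_scale a u : `|a| = 1 -> torus u -> torus (a *: u).
Proof. by move=> a1 tu k; rewrite mxE normrM a1 tu mulr1. Qed.

Lemma entry_invK u : entry_inv (entry_inv u) = u.
Proof. by apply/colP => k; rewrite !mxE invrK. Qed.

Lemma diag_of_inv_torus u : torus u -> diag_of (entry_inv u) *m u = ones.
Proof.
by move=> tu; rewrite diag_ofM; apply/colP => k; rewrite !mxE mulVf ?torus_neq0.
Qed.

Lemma diag_ofV u : torus u -> diag_of u *m diag_of (entry_inv u) = 1%:M.
Proof.
move=> tu; rewrite mul_diag_mx; apply/matrixP => i j; rewrite !mxE.
by case: eqP => [->|_]; rewrite ?mulr0 // mulr1n divff ?torus_neq0.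
Qed.

Lemma diag_of_group u : torus u -> diag_group (diag_of u).
Proof.
move=> tu; split=> [|k]; first exact: diag_mx_is_diag.
by rewrite !mxE eqxx mulr1n.
Qed.

Lemma diag_groupE D : diag_group D -> exists2 u, torus u & D = diag_of u.
Proof.
case=> /diag_mxP[d ->] Dd; exists d^T; last by rewrite /diag_of trmxK.
by move=> k; have := Dd k; rewrite !mxE eqxx mulr1n.
Qed.

Lemma diag_of_unitary u : torus u -> diag_of u \is unitarymx.
Proof.
move=> tu; apply/unitarymxP; rewrite mul_diag_mx.
apply/matrixP => i j; rewrite !mxE.
case: (eqVneq i j) => [->|_]; last by rewrite rmorph0 mulr0.
by rewrite mulr1n -normCK tu expr1n.
Qed.

Lemma det_diag_of u : \det (diag_of u) = \prod_k u k 0.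
Proof. by rewrite det_diag; apply: eq_bigr => k _; rewrite mxE. Qed.

Lemma diag_of_sandwich A v w : torus v -> torus w ->
  diag_of w *m (diag_of (entry_inv w) *m A *m diag_of v)
    *m diag_of (entry_inv v) = A.
Proof.
move=> tv tw; rewrite !mulmxA diag_ofV // mul1mx -mulmxA diag_ofV //.
exact: mulmx1.
Qed.

(** Scaling by [a] multiplies the product by [a ^+ n.+1], so [a] is a root of the inverse
    product. *)
Lemma normalize_torus_prod u : torus u ->
  exists2 a : C, `|a| = 1 & \prod_k (a *: u) k 0 = 1.
Proof.
move=> tu; have p1 : `|(\prod_k u k 0)^-1| = 1.
  by rewrite normfV normr_prod big1 ?invr1.
have [a aE a1] := unimodular_root n p1; exists a => //.
rewrite (eq_bigr (fun k => a * u k 0)) => [|k _]; last by rewrite mxE.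
rewrite big_split /= prodr_const card_ord aE mulVf //.
by rewrite -normr_eq0 -[`|_|]invrK -normfV p1 invr1 oner_eq0.
Qed.

Lemma unitary_scale a A : `|a| = 1 -> A \is unitarymx -> a *: A \is unitarymx.
Proof.
move=> a1 /unitarymxP Au; apply/unitarymxP.
rewrite linearZ /= map_mxZ -scalemxAr -scalemxAl Au scalerA mulrC.
by rewrite -normCK a1 expr1n scale1r.
Qed.

Lemma unitary_norm_det A : A \is unitarymx -> `|\det A| = 1.
Proof.
move=> /unitarymxP /(congr1 determinant).
rewrite det_mulmx det_map_mx det_tr det1 -normCK => /eqP.
by rewrite pexpr_eq1 // => /eqP.
Qed.

(** [S] preserves the Euclidean norm and [ones] is nonzero. *)
Lemma unitary_eigen_ones S c : S \is unitarymx -> S *m ones = c *: ones ->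
  `|c| = 1.
Proof.
move=> Su E; have := unitary_sum_norm2 (@ones R n) Su.
under eq_bigr do rewrite E !mxE mulr1.
under [RHS]eq_bigr do rewrite mxE normr1 expr1n.
rewrite !sumr_const -[LHS]mulr_natr -[RHS]mulr_natr.
move=> /mulIf H; apply/eqP; rewrite -(@pexpr_eq1 _ _ 2) //; apply/eqP/H.
by rewrite pnatr_eq0 card_ord.
Qed.

(** The three factors send [entry_inv v] to [ones], then to [c *: ones], then to [c *: w]. This
    serves the converses of both (a), with [c = 1], and (a'). *)
Lemma biunimodular_diag A S c v w : torus v -> torus w -> `|c| = 1 ->
  S *m ones = c *: ones ->
  A = diag_of w *m S *m diag_of v -> biunimodular A (entry_inv v).
Proof.
move=> tv tw c1 SE ->; split; first exact: torus_inv.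
rewrite -mulmxA.
have -> : diag_of v *m entry_inv v = ones.
  by rewrite -{1}[v]entry_invK diag_of_inv_torus //; exact: torus_inv.
by rewrite -mulmxA SE -scalemxAr diag_of_ones; exact: torus_scale.
Qed.

Lemma biunimodular_scale a A v : `|a| = 1 ->
  biunimodular A v -> biunimodular A (a *: v).
Proof.
by move=> a1 [tv tw]; split; rewrite -?scalemxAr; exact: torus_scale.
Qed.

End Diagonal.

(** * The equivalences, one condition at a time *)

Section Equivalences.
Variables (R : realType) (n : nat) (A : 'M[R[i]]_n.+1).
Hypothesis Au : A \is unitarymx.

Lemma biunimodular_iff_fix_ones :
  (exists v, biunimodular A v) <->
  mulset (mulset diag_group fix_ones) diag_group1 A.
Proof.
split=> [[v bv]|].
  (* Dividing by the first entry puts the right diagonal factor in [diag_group1]. *)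
  have v1 : `|(v 0 0)^-1| = 1 by have [tv _] := bv; rewrite normfV tv invr1.
  have [] := biunimodular_scale v1 bv.
  have : ((v 0 0)^-1 *: v) 0 0 = 1.
    by have [tv _] := bv; rewrite mxE mulVf ?torus_neq0.
  move: (_ *: v) => u u00 tu tw.
  exists (diag_of (A *m u) *m
          (diag_of (entry_inv (A *m u)) *m A *m diag_of u)).
    exists (diag_of (A *m u)); first exact: diag_of_group.
    exists (diag_of (entry_inv (A *m u)) *m A *m diag_of u) => //.
    split; last first.
      by rewrite -!mulmxA diag_of_ones diag_of_inv_torus.
    rewrite /unitary_group /= !mul_unitarymx // diag_of_unitary //.
    exact: torus_inv.
  exists (diag_of (entry_inv u)); last exact: diag_of_sandwich.
  split; first exact/diag_of_group/torus_inv.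
  by rewrite !mxE eqxx u00 invr1.
case=> _ [D1 /diag_groupE[w tw ->] [S [Su SE] <-]].
case=> D2 [/diag_groupE[v tv ->] _] E; exists (entry_inv v).
apply: (@biunimodular_diag _ _ A S 1 v w) => //; first exact: normr1.
by rewrite scale1r.
Qed.

Lemma biunimodular_iff_eigen_ones (lam : R[i]) :
  lam ^+ n.+1 = Num.conj (\det A) ->
  (exists v, biunimodular A v) <->
  mulset (mulset special_diag_group eigen_ones) special_diag_group (lam *: A).
Proof.
move=> lamE; have d1 := unitary_norm_det Au.
have lam1 : `|lam| = 1.
  by apply/eqP; rewrite -(@pexpr_eq1 _ _ n.+1) // -normrX lamE norm_conjC d1.
split=> [[v [tv tw]]|].
  (* Separate scalars for [v] and its image give both diagonal factors determinant 1. *)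
  have [a a1 pa] := normalize_torus_prod tv.
  have [b b1 pb] := normalize_torus_prod tw.
  have {}tv := torus_scale a1 tv; have {}tw := torus_scale b1 tw.
  have sdg (u : 'cV[R[i]]_n.+1) :
      torus u -> \prod_k u k 0 = 1 -> special_diag_group (diag_of u).
    move=> tu pu; split; first exact: diag_of_group.
    by split; [exact: diag_of_unitary | rewrite det_diag_of].
  have pinv (u : 'cV[R[i]]_n.+1) :
      \prod_k u k 0 = 1 -> \prod_k entry_inv u k 0 = 1.
    move=> pu; rewrite (eq_bigr (fun k => (u k 0)^-1)) => [|k _].
      by rewrite prodfV pu invr1.
    by rewrite mxE.
  exists (diag_of (b *: (A *m v)) *m
     (diag_of (entry_inv (b *: (A *m v))) *m (lam *: A) *m diag_of (a *: v))).
    exists (diag_of (b *: (A *m v))); first exact: sdg.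
    exists (diag_of (entry_inv (b *: (A *m v))) *m (lam *: A)
              *m diag_of (a *: v)) => //.
    split; first split.
    - rewrite /unitary_group /= !mul_unitarymx ?unitary_scale //.
        exact/diag_of_unitary/torus_inv.
      exact: diag_of_unitary.
    - rewrite !det_mulmx !det_diag_of pa pinv // mulr1 mul1r detZ lamE.
      by rewrite mulrC -normCK d1 expr1n.
    (* The image of [a *: v] is [a / b] times the rescaled image [b *: (A *m v)]; [lam] comes from
       the middle factor. *)
    - exists (lam * a / b); rewrite -!mulmxA diag_of_ones -scalemxAl.
      have b0 : b != 0 by rewrite -normr_eq0 b1 oner_eq0.
      have -> : lam *: (A *m (a *: v)) = (lam * a / b) *: (b *: (A *m v)).
        by rewrite -scalemxAr !scalerA divfK.
      by rewrite -scalemxAr diag_of_inv_torus.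
  exists (diag_of (entry_inv (a *: v))); last exact: diag_of_sandwich.
  by apply: sdg; [exact: torus_inv | exact: pinv].
case=> _ [D1 [/diag_groupE[w tw ->] _] [S [[Su _] [c SE]] <-]].
case=> D2 [/diag_groupE[v tv ->] _] E; exists (entry_inv v).
have c1 := unitary_eigen_ones Su SE.
have [tv' tAv] := biunimodular_diag tv tw c1 SE (esym E).
(* The vector found is biunimodular for [lam *: A]; as [lam] is unimodular, it is so for [A]. *)
split=> // k; have := tAv k.
by rewrite -scalemxAl mxE normrM lam1 mul1r.
Qed.

Lemma biunimodular_iff_opnorm :
  (exists v, biunimodular A v) <-> opnorm_sup_1 A = n.+1%:R.
Proof.
rewrite /opnorm_sup_1; set E := [set _ | _ in _].
have ubE : ubound E n.+1%:R.
  move=> _ [u /= u1 <-]; apply: norm1_le => // k; rewrite -u1.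
  exact: modulus_le_norm_sup.
have E1 : E (norm1 (A *m ones)).
  by exists ones => //=; exact/norm_sup_torus/torus_ones.
(* Nonemptiness and boundedness make [sup] a genuine least upper bound. *)
have supE : has_sup E by split; [exists (norm1 (A *m ones)) | exists n.+1%:R].
split=> [[v [tv tw]]|EN].
  apply/eqP; rewrite eq_le; apply/andP; split.
    by apply: ge_sup => //; exists (norm1 (A *m ones)).
  apply: ub_le_sup; first by exists n.+1%:R.
  by exists v => /=; [exact: norm_sup_torus | exact: norm1_torus].
apply: (biunimodular_of_norm1_approx Au) => e e0.
have [_ [u /= u1 <-]] := sup_adherent e0 supE; rewrite EN => ue.
by exists u => // k; rewrite -u1; exact: modulus_le_norm_sup.
Qed.

(* AM-GM, together with [x ^ n <= x] on [0, 1]: it reduces (c) to the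
   approximate form of (b). *)
Lemma coord_prod_le_norm1 (u : 'cV[R[i]]_n.+1) :
  (forall k, modulus (u k 0) <= 1) ->
  modulus (coord_prod A u) <= norm1 (A *m u) / n.+1%:R.
Proof.
move=> u1; rewrite modulus_prod.
have [+ _] := @leif_AGM R _ predT (fun k => modulus ((A *m u) k 0))
  (fun k _ => modulus_ge0 _).
rewrite /= card_ord => /le_trans; apply; rewrite -/(norm1 _).
have q0 : 0 <= norm1 (A *m u) / n.+1%:R.
  by rewrite divr_ge0 // sumr_ge0 // => k _; exact: modulus_ge0.
have q1 : norm1 (A *m u) / n.+1%:R <= 1.
  by rewrite ler_pdivrMr // mul1r norm1_le.
by rewrite exprS ler_piMr // exprn_ile1.
Qed.

Lemma biunimodular_iff_coord_prod :
  (exists v, biunimodular A v) <->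
  sup [set modulus (coord_prod A u) | u in torus] = 1.
Proof.
set E := [set _ | _ in _].
have t1 (u : 'cV[R[i]]_n.+1) : torus u -> forall k, modulus (u k 0) <= 1.
  by move=> tu k; rewrite torus_modulus.
have ubE : ubound E 1.
  move=> _ [u /= /t1 u1 <-]; apply: le_trans (coord_prod_le_norm1 u1) _.
  by rewrite ler_pdivrMr // mul1r norm1_le.
have E1 : E (modulus (coord_prod A ones)).
  by exists ones => //=; exact: torus_ones.
have supE : has_sup E.
  by split; [exists (modulus (coord_prod A ones)) | exists 1].
split=> [[v [tv tw]]|EN].
  apply/eqP; rewrite eq_le; apply/andP; split.
    by apply: ge_sup => //; exists (modulus (coord_prod A ones)).
  apply: ub_le_sup; first by exists 1.
  exists v => //; rewrite modulus_prod big1 // => k _; exact: torus_modulus.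
apply: (biunimodular_of_norm1_approx Au) => e e0.
(* The product is at most the mean of the moduli, so a gap [e / n.+1] for it becomes a gap [e] for
   [norm1]. *)
have e0' : 0 < e / n.+1%:R by rewrite divr_gt0.
have [_ [u /= /t1 u1 <-]] := sup_adherent e0' supE; rewrite EN => ue.
exists u => //; have := lt_le_trans ue (coord_prod_le_norm1 u1).
by rewrite ltr_pdivlMr // mulrBl mul1r divfK ?pnatr_eq0.
Qed.

End Equivalences.

Theorem theorem4p1 (R : realType) (n : nat) (A : 'M[R[i]]_n.+1)
    (hA : unitary_group A) :
  [/\ (exists v, biunimodular A v) <->
        mulset (mulset diag_group fix_ones) diag_group1 A,
      forall lam : R[i], lam ^+ n.+1 = Num.conj (\det A) ->
        ((exists v, biunimodular A v) <->
         mulset (mulset special_diag_group eigen_ones) special_diag_group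
           (lam *: A)),
      (exists v, biunimodular A v) <-> opnorm_sup_1 A = n.+1%:R,
      (exists v, biunimodular A v) <->
        sup [set modulus (coord_prod A u) | u in torus] = 1
    & (exists v, biunimodular A v) <->
        [set A *m u | u in torus] `&` torus !=set0].
Proof.
split.
- exact: biunimodular_iff_fix_ones.
- exact: biunimodular_iff_eigen_ones.
- exact: biunimodular_iff_opnorm.
- exact: biunimodular_iff_coord_prod.
- split=> [[v [tv tw]]|[_ [[v tv <-] tw]]]; last by exists v.
  by exists (A *m v); split=> //; exists v.
Qed.
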